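(* Consider the multiparticle model $(T,I,2)$ with two particles $p_1,p_2$ that may move at different constant speeds. If $\|\mathbf{v}_1\|/\|\mathbf{v}_2\|\ge 30$, then for any initial condition $I$ both particles escape to infinity.
   Context: **Lattice.** $T=(\mathbb{T},\mathbb{B})$ is the triangular lattice with sites $\mathbb{T}=\{a(1,0)+b(1/2,\sqrt3/2):a,b\in\mathbb{Z}\}\subset\mathbb{R}^2$; its bonds $\mathbb{B}$ are the unit segments joining sites at distance $1$ (each site has six neighbors). **Multiparticle model $(T,I,N)$ with different speeds.** There are $N$ particles $p_1,\dots,p_N$ moving in continuous time $t\ge0$ along the bonds of $T$. Particle $p_i$ has position $\mathbf{r}_i(t)$ and velocity $\mathbf{v}_i(t)$, pointing in one of the six bond directions, with constant speed $\|\mathbf{v}_i(t)\|=\|\mathbf{v}_i\|>0$, where $\mathbf{v}_i$ is its initial velocity. Every site $\mathbf{h}\in\mathbb{T}$ carries a scatterer that is at each time either a left rotator or a right rotator. An initial condition $I=(\bar{\mathbf{r}},\bar{\mathbf{v}},C)$ consists of the initial positions of the particles on the lattice bonds, their initial velocities along those bonds, and an arbitrary assignment $C$ of an orientation (left or right) to every site. Each particle moves linearly along a bond until it reaches a site; if the scatterer there is a left (right) rotator, the particle's velocity is rotated by the angle $2\pi/3$ to its left, i.e. counterclockwise (to its right, i.e. clockwise), the particle leaves along the corresponding bond, and immediately after scattering the particle the rotator flips orientation (left to right, or right to left). Particles do not interact directly with one another, even when meeting on a bond. It is assumed that no two particles are ever at the same site at the same time. **Escape to infinity.** $p_i$ escapes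 to infinity if $\|\mathbf{r}_i(t)\|\to\infty$ as $t\to\infty$. *)

(* Defs.v *)
From Stdlib Require Import Reals ZArith.
From Stdlib Require Fin.
From Coquelicot Require Import Coquelicot.
Open Scope R_scope.

(** The plane is Coquelicot's [C], that is [R * R] with Euclidean norm [Cmod];
    rotation by the angle [a] is multiplication by [(cos a, sin a)]. *)
Definition rotate (a : R) (w : C) : C := Cmult (cos a, sin a) w.

(** The site with lattice coordinates [(a, b)] is a(1,0) + b(1/2, sqrt 3 / 2). *)
Definition site : Type := (Z * Z)%type.

Definition site_pos (h : site) : C :=
  (IZR (fst h) + IZR (snd h) / 2, IZR (snd h) * (sqrt 3 / 2)).

Definition is_site (x : C) : Prop := exists h : site, x = site_pos h.

Definition adjacent (h k : site) : Prop :=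
  Cmod (Cminus (site_pos k) (site_pos h)) = 1.

Inductive rotator : Type := Left | Right.

Definition flip (o : rotator) : rotator :=
  match o with Left => Right | Right => Left end.

Definition scatter (o : rotator) (w : C) : C :=
  match o with
  | Left => rotate (2 * PI / 3) w
  | Right => rotate (- (2 * PI / 3)) w
  end.

(** Bonds are unordered, so taking the velocity to point from [h] to [k] covers
    both directions of travel. *)
Definition on_bond_with_velocity (x w : C) : Prop :=
  exists h k : site, adjacent h k /\
    let d := Cminus (site_pos k) (site_pos h) in
    (exists l : R, 0 <= l <= 1 /\ x = Cplus (site_pos h) (Cmult (RtoC l) d)) /\
    (exists c : R, 0 < c /\ w = Cmult (RtoC c) d).

Record initial_condition (N : nat) : Type := {
  init_pos : Fin.t N -> C;
  init_vel : Fin.t N -> C;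
  init_conf : site -> rotator;
  init_on_bonds : forall i, on_bond_with_velocity (init_pos i) (init_vel i)
}.
Arguments init_pos {N}.
Arguments init_vel {N}.
Arguments init_conf {N}.

(** Velocities and rotators are left-continuous in time: when a particle is at a
    site at time [t], [vel] is its incoming velocity and [conf] the orientation
    it finds there. In particular a particle that starts at a site is scattered
    there at time 0; reading its initial velocity as already outgoing would amount
    to rotating that velocity and flipping that rotator in the initial condition.
    Only times [t >= 0] are constrained below. *)
Record history (N : nat) : Type := {
  pos : Fin.t N -> R -> C;
  vel : Fin.t N -> R -> C;
  conf : R -> site -> rotator
}.
Arguments pos {N}.
Arguments vel {N}.
Arguments conf {N}.

Definition visited {N : nat} (E : history N) (t : R) (h : site) : Prop :=
  exists i, pos E i t = site_pos h.

(** [w] is the velocity of particle [i] immediately after time [t]. *)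
Definition outgoing {N : nat} (E : history N) (i : Fin.t N) (t : R) (w : C) : Prop :=
  (exists h, pos E i t = site_pos h /\ w = scatter (conf E t h) (vel E i t)) \/
  (~ is_site (pos E i t) /\ w = vel E i t).

Record evolution {N : nat} (I : initial_condition N) (E : history N) : Prop := {
  evol_pos0 : forall i, pos E i 0 = init_pos I i;
  evol_vel0 : forall i, vel E i 0 = init_vel I i;
  evol_conf0 : forall h, conf E 0 h = init_conf I h;
  (** Uniform motion, up to and including the arrival at the next site. *)
  evol_flight : forall i s t w, 0 <= s < t -> outgoing E i s w ->
    (forall u, s < u < t ->
       ~ is_site (Cplus (pos E i s) (Cmult (RtoC (u - s)) w))) ->
    pos E i t = Cplus (pos E i s) (Cmult (RtoC (t - s)) w) /\ vel E i t = w;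
  evol_flip : forall s t h, 0 <= s < t ->
    (forall u, s < u < t -> ~ visited E u h) ->
    visited E s h -> conf E t h = flip (conf E s h);
  evol_keep : forall s t h, 0 <= s < t ->
    (forall u, s <= u < t -> ~ visited E u h) -> conf E t h = conf E s h
}.

Definition no_simultaneous_visits {N : nat} (E : history N) : Prop :=
  forall t i j h, 0 <= t ->
    pos E i t = site_pos h -> pos E j t = site_pos h -> i = j.

Definition escapes {N : nat} (E : history N) (i : Fin.t N) : Prop :=
  is_lim (fun t => Cmod (pos E i t)) p_infty p_infty.

Definition p1 : Fin.t 2 := Fin.F1.
Definition p2 : Fin.t 2 := Fin.FS Fin.F1.

(* Main.v *)
(** A particle alone on the lattice is within nine steps, whatever the rotators, in a regime
    where three rotators behind it are set so that it zigzags along a straight line: an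
    unfavourable rotator ahead only costs a loop of six steps around the last triangles,
    which leaves the rotators behind it as the favourable one would.  So it advances one
    zigzag bond (half a unit) at least every seven steps.

    The slow particle can disturb the fast one only by visiting one of the few sites on
    which this regime relies, and the fast particle makes at least thirty steps between two
    such visits.  An exhaustive symbolic execution of both particles, branching on the
    rotators not yet seen, shows that after a disturbance at most a few consecutive visits
    can disturb again; then the fast particle has too large a lead and is never disturbed
    any more.  From some time on it is so far from the slow one that the latter, in turn,
    moves as if it were alone. *)

Require Import Defs.
From Stdlib Require Import Reals ZArith List Bool Lia Lra Classical.
From Coquelicot Require Import Coquelicot.
Import ListNotations.
Open Scope Z_scope.

(** * Lattice vectors in integer coordinates *)

Definition vadd (x y : site) : site := (fst x + fst y, snd x + snd y).
Definition vsub (x y : site) : site := (fst x - fst y, snd x - snd y).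

Definition turn (o : rotator) (u : site) : site :=
  match o with
  | Left => (- fst u - snd u, fst u)
  | Right => (snd u, - fst u - snd u)
  end.

Definition directions : list site := [(1,0); (0,1); (-1,1); (-1,0); (0,-1); (1,-1)].

Definition site_eqb (x y : site) : bool := (fst x =? fst y) && (snd x =? snd y).

Definition rotator_eqb (a b : rotator) : bool :=
  match a, b with Left, Left | Right, Right => true | _, _ => false end.

Definition upd (f : site -> rotator) (x h : site) : rotator :=
  if site_eqb h x then flip (f h) else f h.

(** Minus twice the Euclidean inner product of [w] and [x]. *)
Definition phi (w x : site) : Z :=
  - (2 * fst x * fst w + 2 * snd x * snd w + fst x * snd w + snd x * fst w).

Lemma site_eqb_spec (x y : site) : reflect (x = y) (site_eqb x y).
Proof.
  destruct x as [a b], y as [c d]. unfold site_eqb; simpl.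
  destruct (Z.eqb_spec a c), (Z.eqb_spec b d); constructor; congruence.
Qed.

Lemma rotator_eqb_eq (a b : rotator) : rotator_eqb a b = true -> a = b.
Proof. now destruct a, b. Qed.

Lemma flip_flip (o : rotator) : flip (flip o) = o.
Proof. now destruct o. Qed.

Ltac case_direction H :=
  simpl in H;
  repeat match type of H with _ \/ _ => destruct H as [H | H] end;
  [ .. | contradiction H].

Lemma turn_direction (o : rotator) (u : site) :
  In u directions -> In (turn o u) directions.
Proof. intros H. case_direction H; subst u; destruct o; simpl; tauto. Qed.

(** [w] and [u] are unit vectors, so their inner product is at least -1. *)
Lemma phi_step (w x u : site) :
  In w directions -> In u directions -> phi w (vadd x u) <= phi w x + 2.
Proof.
  intros Hw Hu. case_direction Hw; subst w; case_direction Hu; subst u;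
    unfold phi, vadd; cbn [fst snd]; lia.
Qed.

(** * Phases of the propagating regime *)

(** At tick [0] a particle that has zigzagged along [px0], [px1], [px2] arrives at
    [base] heading along [lead].  If it is turned to [side] there it advances to the
    next base; otherwise ticks [1] to [6] describe the loop
    [px1], [px2], [px0], [px1], [px2], [base], after which it advances. *)
Record phase : Type := Phase { base : site; lead : site; side : rotator; tick : nat }.

Definition px1 (F : phase) : site := vsub (vsub (base F) (lead F)) (turn (side F) (lead F)).
Definition px2 (F : phase) : site := vsub (base F) (lead F).
Definition px0 (F : phase) : site := vsub (px1 F) (lead F).

(** Propagation is in the direction [- axis F]. *)
Definition axis (F : phase) : site := turn (flip (side F)) (lead F).

Definition phase_site (F : phase) : site :=
  match tick F with
  | 0 => base F | 1 => px1 F | 2 => px2 F | 3 => px0 F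
  | 4 => px1 F | 5 => px2 F | _ => base F
  end%nat.

Definition phase_dir (F : phase) : site :=
  match tick F with
  | 0 | 4 | 6 => lead F
  | 2 | 5 => turn (side F) (lead F)
  | _ => axis F
  end%nat.

(** The last three zigzag sites, and [base F] once entering the loop has revealed its rotator. At
    tick 6 [px1] and [px2] are back to their values at tick 0, while [base F] now holds the
    favourable [s]. *)
Definition phase_conf (F : phase) : list (site * rotator) :=
  let s := side F in let r := flip s in
  match tick F with
  | 0 => [(px2 F, s); (px1 F, r); (px0 F, s)]
  | 1 => [(px2 F, s); (px1 F, r); (px0 F, s); (base F, s)]
  | 2 => [(px2 F, s); (px1 F, s); (px0 F, s); (base F, s)]
  | 3 => [(px2 F, r); (px1 F, s); (px0 F, s); (base F, s)]
  | 4 => [(px2 F, r); (px1 F, s); (px0 F, r); (base F, s)]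
  | 5 => [(px2 F, r); (px1 F, r); (px0 F, r); (base F, s)]
  | _ => [(px2 F, s); (px1 F, r); (px0 F, r); (base F, s)]
  end%nat.

(** Every base of a run is one [phi]-unit after the previous one and is reached within
    seven steps, so [level] grows by at least one per step. *)
Definition level (F : phase) : Z := 7 * phi (axis F) (base F) + Z.of_nat (tick F).
(** How far the regime has left [a] behind, in units of [level]. Being a difference, it does not
    depend on the choice of origin. *)
Definition gain (F : phase) (a : site) : Z := level F - 7 * phi (axis F) a.

Record in_phase (F : phase) (x d : site) (f : site -> rotator) : Prop := {
  in_phase_lead : In (lead F) directions;
  in_phase_tick : (tick F <= 6)%nat;
  in_phase_site : x = phase_site F;
  in_phase_dir : d = phase_dir F;
  in_phase_conf : forall p, In p (phase_conf F) -> f (fst p) = snd p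
}.

Lemma in_phase_ext (F : phase) (x d : site) (f g : site -> rotator) :
  (forall p, In p (phase_conf F) -> g (fst p) = f (fst p)) ->
  in_phase F x d f -> in_phase F x d g.
Proof.
  intros H [H1 H2 H3 H4 H5]. constructor; auto.
  intros p Hp. rewrite H by auto. auto.
Qed.

(** * Symbolic execution *)

(** [known] has the latest entries first, so that [lookup] finds the current orientation. *)
Record sym : Type := Sym { at_site : site; heading : site; known : list (site * rotator) }.

Fixpoint lookup (h : site) (l : list (site * rotator)) : option rotator :=
  match l with
  | [] => None
  | (k, o) :: l => if site_eqb h k then Some o else lookup h l
  end.

Definition sym_step (st : sym) : list sym :=
  map (fun o => let d := turn o (heading st) in
         Sym (vadd (at_site st) d) d ((at_site st, flip o) :: known st))
      (match lookup (at_site st) (known st) with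
       | Some o => [o] | None => [Left; Right] end).

Definition agrees (l : list (site * rotator)) (p : site * rotator) : bool :=
  match lookup (fst p) l with Some o => rotator_eqb o (snd p) | None => false end.

(* Nested conditionals instead of [&&] and [||], which evaluate both arguments. *)
Definition matches (st : sym) (F : phase) : bool :=
  if site_eqb (heading st) (phase_dir F) then
    if site_eqb (at_site st) (phase_site F) then forallb (agrees (known st)) (phase_conf F)
    else false
  else false.

(** [phase_dir F] is [lead F] up to a turn, so the lead is the heading or one of its two turns; the
    position then determines the base. *)
Definition candidates (st : sym) : list phase :=
  flat_map (fun s => flat_map (fun j => map (fun u =>
     Phase (vsub (at_site st) (phase_site (Phase (0,0) u s j))) u s j)
     [heading st; turn Left (heading st); turn Right (heading st)])
     (seq 0 7)) [Left; Right].

Definition fresh_phases (st : sym) : list phase :=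
  map (fun s => Phase (at_site st) (heading st) s 0) [Left; Right].

(* A visit to [a] is harmless when [gain F a] is at least 28, since the sites of
   [phase_conf F] have gain at most 27.  After a visit to a site of gain at least 12 that
   spares [phase_conf F], the gain grows by at least 30 (one per step) and drops by at most
   14 (one step of the second particle) until the next visit, hence is then at least 28. *)
Definition settled (K : Z) (a : site) (st : sym) : bool :=
  existsb (fun F => if matches st F then K <=? gain F a else false) (fresh_phases st).

Definition involves (F : phase) (a : site) : bool :=
  existsb (fun p => site_eqb a (fst p)) (phase_conf F).

Definition harmless (a : site) (st : sym) : bool :=
  existsb (fun F => if matches st F then (12 <=? gain F a) && negb (involves F a) else false)
    (candidates st).

(** The second particle next visits [a], after at least [r] more steps. *)
Fixpoint clear (r : nat) (a : site) (k : sym -> bool) (st : sym) : bool :=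
  if settled (28 - Z.of_nat r) a st then true else
  match r with O => k st | S r => forallb (clear r a k) (sym_step st) end.

(** The moment of the visit is unknown: [visit] is required of every state until the particle is
    settled, and every branch must settle within [n] steps. *)
Fixpoint wait (n : nat) (a : site) (visit : sym -> bool) (st : sym) : bool :=
  if settled 28 a st then true else
  if visit st then
    match n with O => false | S n => forallb (wait n a visit) (sym_step st) end
  else false.

(** The second particle visits [a], where it arrives with direction [u]. *)
Fixpoint chase (D : nat) (st : sym) (a u : site) : bool :=
  match D with
  | O => false
  | S D =>
    match lookup a (known st) with
    | None => false
    | Some o =>
      let u' := turn o u in let a' := vadd a u' in
      clear 30 a' (wait 18 a' (fun st => if harmless a' st then true else chase D st a' u'))
        (Sym (at_site st) (heading st) ((a, flip o) :: known st))
    end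
  end.

(** * Finite checks by computation *)

Definition start (F : phase) : sym := Sym (phase_site F) (phase_dir F) (phase_conf F).
Definition standard (j : nat) : phase := Phase (0, 0) (1, 0) Left j.

(** All ticks, all relevant sites and all six arrival directions are executed. The computation shows
    that five consecutive disturbing visits, and 18 steps beyond the 30 guaranteed between visits,
    are enough. *)
Lemma chase_standard (j : nat) (a u : site) (o : rotator) :
  (j <= 6)%nat -> In u directions -> In (a, o) (phase_conf (standard j)) ->
  chase 5 (start (standard j)) a u = true.
Proof.
  intros Hj Hu Ha.
  assert (H : forallb (fun j => forallb (fun p =>
      forallb (chase 5 (start (standard j)) (fst p)) directions)
      (phase_conf (standard j))) (seq 0 7) = true) by (vm_compute; reflexivity).
  rewrite forallb_forall in H. specialize (H j).
  rewrite forallb_forall in H. specialize (fun p => H p (a, o)).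
  rewrite forallb_forall in H. simpl fst in H.
  apply H; auto. apply in_seq; lia.
Qed.

Definition nearb (r : Z) (x y : site) : bool :=
  (Z.abs (fst x - fst y) <=? r) && (Z.abs (snd x - snd y) <=? r).

(** The bound 10 on the distance to known rotators makes the search local, so that a walker may
    ignore flips far away. *)
Fixpoint explore (n : nat) (st : sym) : bool :=
  if existsb (matches st) (fresh_phases st) then true else
  match n with
  | O => false
  | S n => forallb (fun st' => forallb (fun p => nearb 10 (fst p) (at_site st)) (known st')
             && explore n st') (sym_step st)
  end.

Lemma explore_standard : explore 9 (Sym (0, 0) (1, 0) []) = true.
Proof. vm_compute. reflexivity. Qed.

Definition advances (F : phase) (st : sym) : bool :=
  existsb (fun F' => matches st F' && site_eqb (axis F') (axis F)
     && (level F + 1 <=? level F') && existsb (site_eqb (lead F')) directions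
     && (tick F' <=? 6)%nat && forallb (fun p => nearb 10 (fst p) (phase_site F)) (phase_conf F'))
    (candidates st).

Lemma advances_standard (j : nat) (st : sym) :
  (j <= 6)%nat -> In st (sym_step (start (standard j))) -> advances (standard j) st = true.
Proof.
  intros Hj Hs.
  assert (H : forallb (fun j => forallb (advances (standard j))
     (sym_step (start (standard j)))) (seq 0 7) = true) by (vm_compute; reflexivity).
  rewrite forallb_forall in H. specialize (H j).
  rewrite forallb_forall in H. apply H; auto. apply in_seq; lia.
Qed.

(** * Frames *)

(** A symmetry of the lattice: [(1, 0)] goes to [ex], and the orientation is reversed
    when [mir] holds. *)
Record frame : Type := Frame { org : site; ex : site; mir : bool }.

(** The image of [(0, 1)]: [ex e] rotated by 60 degrees, clockwise when [mir e] holds. *)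
Definition ey (e : frame) : site :=
  let (p, q) := ex e in if mir e then (p + q, - p) else (- q, p + q).
(** Multiplication by [ex e] in the Eisenstein integers, preceded by conjugation when [mir e]
    holds. *)
Definition fvec (e : frame) (x : site) : site :=
  (fst x * fst (ex e) + snd x * fst (ey e), fst x * snd (ex e) + snd x * snd (ey e)).
Definition fpt (e : frame) (x : site) : site := vadd (org e) (fvec e x).
Definition frot (e : frame) (o : rotator) : rotator := if mir e then flip o else o.
Definition fphase (e : frame) (F : phase) : phase :=
  Phase (fpt e (base F)) (fvec e (lead F)) (frot e (side F)) (tick F).

Lemma frot_flip (e : frame) (o : rotator) : frot e (flip o) = flip (frot e o).
Proof. unfold frot. destruct (mir e); now rewrite ?flip_flip. Qed.

Lemma frot_invol (e : frame) (o : rotator) : frot e (frot e o) = o.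
Proof. unfold frot. destruct (mir e); now rewrite ?flip_flip. Qed.

(** A turn is multiplication by a cube root of unity: it commutes with multiplication by [ex e], and
    conjugation exchanges the two turns. *)
Lemma fvec_turn (e : frame) (o : rotator) (u : site) :
  fvec e (turn o u) = turn (frot e o) (fvec e u).
Proof.
  destruct e as [g [p q] m], u as [a b]. unfold fvec, frot, ey.
  destruct m, o; cbn [turn flip fst snd ex mir]; f_equal; ring.
Qed.

Lemma fvec_vadd (e : frame) (x y : site) : fvec e (vadd x y) = vadd (fvec e x) (fvec e y).
Proof. unfold fvec, vadd; cbn [fst snd]; f_equal; ring. Qed.

Lemma fpt_vadd (e : frame) (x y : site) : fpt e (vadd x y) = vadd (fpt e x) (fvec e y).
Proof. unfold fpt. rewrite fvec_vadd. unfold vadd; cbn [fst snd]; f_equal; ring. Qed.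

Lemma fpt_vsub (e : frame) (x y : site) : fpt e (vsub x y) = vsub (fpt e x) (fvec e y).
Proof. unfold fpt, fvec, vsub, vadd; cbn [fst snd]; f_equal; ring. Qed.

Lemma fvec_inj (e : frame) (x y : site) :
  In (ex e) directions -> fvec e x = fvec e y -> x = y.
Proof.
  destruct e as [g d m], x as [a b], y as [a' b']. cbn [ex]. intros H.
  case_direction H; subst d; destruct m; unfold fvec, ey; cbn [fst snd ex mir];
    injection 1; intros; f_equal; lia.
Qed.

Lemma fpt_inj (e : frame) (x y : site) :
  In (ex e) directions -> fpt e x = fpt e y -> x = y.
Proof.
  intros H E. apply (fvec_inj e); auto. revert E. unfold fpt, vadd.
  destruct (fvec e x), (fvec e y); simpl. injection 1; intros; f_equal; lia.
Qed.

Lemma fvec_direction (e : frame) (u : site) :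
  In (ex e) directions -> In u directions -> In (fvec e u) directions.
Proof.
  destruct e as [g d m]. cbn [ex]. intros Hd Hu.
  case_direction Hd; subst d; case_direction Hu; subst u; destruct m; simpl; tauto.
Qed.

Lemma fvec_onto (e : frame) (u : site) :
  In (ex e) directions -> In u directions ->
  exists u', In u' directions /\ u = fvec e u'.
Proof.
  destruct e as [g d m]. cbn [ex]. intros Hd Hu.
  assert (H : existsb (fun u' => site_eqb u (fvec (Frame g d m) u')) directions = true)
    by (case_direction Hd; subst d; case_direction Hu; subst u; destruct m; reflexivity).
  apply existsb_exists in H. destruct H as (u' & Hu' & E). exists u'. split; auto.
  now destruct (site_eqb_spec u (fvec (Frame g d m) u')).
Qed.

Lemma phi_fvec (e : frame) (w x : site) :
  In (ex e) directions -> phi (fvec e w) (fvec e x) = phi w x.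
Proof.
  destruct e as [g d m], w, x. cbn [ex]. intros Hd.
  case_direction Hd; subst d; destruct m; unfold phi, fvec, ey; cbn [fst snd ex mir]; ring.
Qed.

Lemma phi_fpt (e : frame) (w x y : site) :
  In (ex e) directions ->
  phi (fvec e w) (fpt e x) - phi (fvec e w) (fpt e y) = phi w x - phi w y.
Proof.
  intros H. rewrite <- (phi_fvec e w x), <- (phi_fvec e w y) by auto.
  unfold fpt, phi, vadd; cbn [fst snd]; ring.
Qed.

(** Each new coordinate is, up to signs, a sum of at most two old ones; hence the factor 2. *)
Lemma near_fpt (e : frame) (r : Z) (x y : site) :
  In (ex e) directions -> nearb r x y = true -> nearb (2 * r) (fpt e x) (fpt e y) = true.
Proof.
  destruct e as [[g g'] d m], x as [a b], y as [a' b']. cbn [ex]. intros H.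
  unfold nearb. rewrite !andb_true_iff, !Z.leb_le.
  case_direction H; subst d; destruct m; unfold fpt, fvec, ey, vadd; cbn [fst snd org ex mir]; lia.
Qed.

Lemma px1_fphase (e : frame) (F : phase) : px1 (fphase e F) = fpt e (px1 F).
Proof. unfold px1; simpl. now rewrite !fpt_vsub, fvec_turn. Qed.

Lemma px2_fphase (e : frame) (F : phase) : px2 (fphase e F) = fpt e (px2 F).
Proof. unfold px2; simpl. now rewrite !fpt_vsub. Qed.

Lemma px0_fphase (e : frame) (F : phase) : px0 (fphase e F) = fpt e (px0 F).
Proof. unfold px0. rewrite px1_fphase; simpl. now rewrite !fpt_vsub. Qed.

Lemma axis_fphase (e : frame) (F : phase) : axis (fphase e F) = fvec e (axis F).
Proof. unfold axis; simpl. now rewrite fvec_turn, frot_flip. Qed.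

Lemma phase_site_fphase (e : frame) (F : phase) :
  phase_site (fphase e F) = fpt e (phase_site F).
Proof.
  unfold phase_site. cbn [tick fphase base]. rewrite px0_fphase, px1_fphase, px2_fphase.
  now destruct (tick F) as [|[|[|[|[|[|]]]]]].
Qed.

Lemma phase_dir_fphase (e : frame) (F : phase) :
  phase_dir (fphase e F) = fvec e (phase_dir F).
Proof.
  unfold phase_dir. cbn [tick fphase lead side]. rewrite axis_fphase, <- fvec_turn.
  now destruct (tick F) as [|[|[|[|[|[|[|]]]]]]].
Qed.

Lemma phase_conf_fphase (e : frame) (F : phase) :
  phase_conf (fphase e F) = map (fun p => (fpt e (fst p), frot e (snd p))) (phase_conf F).
Proof.
  unfold phase_conf. cbn [tick fphase base side].
  rewrite px0_fphase, px1_fphase, px2_fphase, <- frot_flip.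
  now destruct (tick F) as [|[|[|[|[|[|]]]]]].
Qed.

Lemma gain_fphase (e : frame) (F : phase) (a : site) :
  In (ex e) directions -> gain (fphase e F) (fpt e a) = gain F a.
Proof.
  intros H. unfold gain, level. rewrite axis_fphase. cbn [fphase base tick].
  pose proof (phi_fpt e (axis F) (base F) a H). lia.
Qed.

Lemma phase_standard (F : phase) :
  exists e, F = fphase e (standard (tick F)) /\ ex e = lead F.
Proof.
  destruct F as [b u s j].
  (* This frame takes the origin to [b], [(1, 0)] to [u] and [Left] to [s]. *)
  exists (Frame b u (rotator_eqb s Right)). split; auto.
  unfold fphase, standard, fpt, fvec, frot, ey, vadd.
  destruct b, u, s; cbn [rotator_eqb org ex mir base lead side tick fst snd flip];
    f_equal; f_equal; ring.
Qed.

(** * Soundness of symbolic execution *)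

Record holds (e : frame) (st : sym) (x d : site) (f : site -> rotator) : Prop := {
  holds_frame : In (ex e) directions;
  holds_site : x = fpt e (at_site st);
  holds_dir : d = fvec e (heading st);
  holds_known : forall h o, lookup h (known st) = Some o -> f (fpt e h) = frot e o
}.

Lemma lookup_In (h : site) (o : rotator) (l : list (site * rotator)) :
  lookup h l = Some o -> In (h, o) l.
Proof.
  induction l as [|[k o'] l IH]; simpl; [discriminate|].
  destruct (site_eqb_spec h k); [left; congruence | auto].
Qed.

Lemma holds_ext (e : frame) (st : sym) (x d : site) (f g : site -> rotator) :
  (forall p, In p (known st) -> g (fpt e (fst p)) = f (fpt e (fst p))) ->
  holds e st x d f -> holds e st x d g.
Proof.
  intros H [H1 H2 H3 H4]. constructor; auto.
  intros h o Ho. rewrite <- (H4 h o Ho). apply (H (h, o)). now apply lookup_In.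
Qed.

Lemma sym_step_sound (e : frame) (st : sym) (x d : site) (f : site -> rotator) :
  holds e st x d f ->
  exists st', In st' (sym_step st) /\
    holds e st' (vadd x (turn (f x) d)) (turn (f x) d) (upd f x).
Proof.
  intros [He -> -> Hk].
  (* The true rotator, pulled back to the frame, selects the branch. *)
  set (o := frot e (f (fpt e (at_site st)))).
  assert (Eo : f (fpt e (at_site st)) = frot e o) by (symmetry; apply frot_invol).
  exists (let d := turn o (heading st) in
     Sym (vadd (at_site st) d) d ((at_site st, flip o) :: known st)).
  split.
  - unfold sym_step. apply (in_map (fun o => let d := turn o (heading st) in
         Sym (vadd (at_site st) d) d ((at_site st, flip o) :: known st))).
    destruct (lookup (at_site st) (known st)) as [o'|] eqn:E.
    + left. apply Hk in E. rewrite Eo in E. apply (f_equal (frot e)) in E.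
      now rewrite !frot_invol in E.
    + destruct o; simpl; tauto.
  - rewrite Eo. constructor; simpl; auto.
    + now rewrite fpt_vadd, fvec_turn.
    + now rewrite fvec_turn.
    + intros h o' Ho. unfold upd.
      destruct (site_eqb_spec h (at_site st)) as [-> | Hn].
      * injection Ho as <-. destruct (site_eqb_spec (fpt e (at_site st)) (fpt e (at_site st)));
          [|congruence]. now rewrite Eo, frot_flip.
      * destruct (site_eqb_spec (fpt e h) (fpt e (at_site st))) as [E|]; [|auto].
        now apply fpt_inj in E.
Qed.

Lemma matches_sound (e : frame) (st : sym) (F : phase) (x d : site) (f : site -> rotator) :
  matches st F = true -> In (lead F) directions -> (tick F <= 6)%nat ->
  holds e st x d f -> in_phase (fphase e F) x d f.
Proof.
  unfold matches. intros M HF Ht [He -> -> Hk].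
  destruct (site_eqb_spec (heading st) (phase_dir F)) as [Ed|]; [|discriminate].
  destruct (site_eqb_spec (at_site st) (phase_site F)) as [Es|]; [|discriminate].
  constructor; auto.
  - cbn [lead fphase]. now apply fvec_direction.
  - now rewrite phase_site_fphase, Es.
  - now rewrite phase_dir_fphase, Ed.
  - intros p Hp. rewrite phase_conf_fphase in Hp. apply in_map_iff in Hp.
    destruct Hp as ([h o] & <- & Hp). simpl. apply Hk.
    rewrite forallb_forall in M. specialize (M _ Hp). unfold agrees in M. simpl in M.
    destruct (lookup h (known st)); [|discriminate]. f_equal. now apply rotator_eqb_eq.
Qed.

Lemma start_sound (e : frame) (F : phase) (x d : site) (f : site -> rotator) :
  In (ex e) directions -> in_phase (fphase e F) x d f -> holds e (start F) x d f.
Proof.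
  intros He [_ _ -> -> H]. constructor; simpl; auto.
  - apply phase_site_fphase.
  - apply phase_dir_fphase.
  - intros h o Ho. apply lookup_In in Ho. rewrite phase_conf_fphase in H.
    apply (H (fpt e h, frot e o)).
    now apply (in_map (fun p => (fpt e (fst p), frot e (snd p))) _ (h, o)).
Qed.

Lemma phase_step (F : phase) (x d : site) (f : site -> rotator) :
  in_phase F x d f ->
  exists F', in_phase F' (vadd x (turn (f x) d)) (turn (f x) d) (upd f x) /\
    axis F' = axis F /\ level F + 1 <= level F' /\
    (forall p, In p (phase_conf F') -> nearb 20 (fst p) x = true).
Proof.
  intros HF.
  destruct (phase_standard F) as (e & EF & Ee).
  assert (He : In (ex e) directions) by (rewrite Ee; apply HF).
  pose proof (in_phase_tick _ _ _ _ HF) as Ht. set (j := tick F) in *. clearbody j.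
  subst F. destruct (sym_step_sound e _ x d f (start_sound e _ x d f He HF)) as (st & Hst & Hh).
  pose proof (advances_standard j st Ht Hst) as A.
  unfold advances in A. apply existsb_exists in A. destruct A as (F' & _ & A).
  rewrite !andb_true_iff in A. destruct A as (((((A1 & A2) & A3) & A4) & A5) & A6).
  exists (fphase e F'). split; [|split; [|split]].
  - apply (matches_sound e st); auto.
    + apply existsb_exists in A4. destruct A4 as (u & Hu & E).
      destruct (site_eqb_spec (lead F') u); [now subst u | discriminate].
    + now apply Nat.leb_le.
  - rewrite !axis_fphase. f_equal.
    now destruct (site_eqb_spec (axis F') (axis (standard j))).
  - apply Z.leb_le in A3.
    assert (axis F' = axis (standard j)) as E
      by now destruct (site_eqb_spec (axis F') (axis (standard j))).
    (* [level] is not invariant under frames, but gains over one common point are, and for equal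
       axes they differ by the difference of levels. *)
    pose proof (gain_fphase e F' (0, 0) He) as G1.
    pose proof (gain_fphase e (standard j) (0, 0) He) as G2.
    unfold gain in G1, G2. rewrite !axis_fphase, ?E in *. lia.
  - intros p Hp. rewrite phase_conf_fphase in Hp. apply in_map_iff in Hp.
    destruct Hp as (q & <- & Hq). simpl fst.
    rewrite (in_phase_site _ _ _ _ HF), phase_site_fphase.
    apply (near_fpt e 10); auto. rewrite forallb_forall in A6. now apply A6.
Qed.

(** The rearmost site [px0 F] is three [phi]-units behind [base F], and [tick F] is at most 6: 3 * 7
    + 6 = 27. *)
Lemma phase_bounds (F : phase) (x d : site) (f : site -> rotator) :
  in_phase F x d f ->
  0 <= gain F x <= 27 /\ (forall p, In p (phase_conf F) -> gain F (fst p) <= 27).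
Proof.
  intros HF.
  destruct (phase_standard F) as (e & EF & Ee).
  assert (He : In (ex e) directions) by (rewrite Ee; apply HF).
  pose proof (in_phase_tick _ _ _ _ HF) as Ht. set (j := tick F) in *. clearbody j.
  subst F.
  assert (H : forallb (fun j => (0 <=? gain (standard j) (phase_site (standard j)))
      && (gain (standard j) (phase_site (standard j)) <=? 27)
      && forallb (fun p => gain (standard j) (fst p) <=? 27) (phase_conf (standard j)))
      (seq 0 7) = true) by (vm_compute; reflexivity).
  rewrite forallb_forall in H. specialize (H j).
  rewrite !andb_true_iff, !Z.leb_le, forallb_forall in H.
  destruct H as ((H1 & H2) & H3); [apply in_seq; lia|].
  rewrite (in_phase_site _ _ _ _ HF), phase_site_fphase, gain_fphase by auto.
  split; [lia|]. intros p Hp. rewrite phase_conf_fphase in Hp. apply in_map_iff in Hp.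
  destruct Hp as (q & <- & Hq). simpl fst. rewrite gain_fphase by auto.
  now apply Z.leb_le, H3.
Qed.

Lemma axis_direction (F : phase) (x d : site) (f : site -> rotator) :
  in_phase F x d f -> In (axis F) directions.
Proof. intros HF. apply turn_direction, HF. Qed.

Lemma holds_heading (e : frame) (st : sym) (x d : site) (f : site -> rotator) :
  holds e st x d f -> In d directions -> In (heading st) directions.
Proof.
  intros [He _ Hd _] H. destruct (fvec_onto e d He H) as (u & Hu & Eu).
  rewrite Hd in Eu. apply fvec_inj in Eu; auto. now rewrite Eu.
Qed.

Lemma fresh_phases_sound (e : frame) (st : sym) (x d : site) (f : site -> rotator) (F : phase) :
  holds e st x d f -> In d directions -> In F (fresh_phases st) -> matches st F = true ->
  in_phase (fphase e F) x d f.
Proof.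
  intros Hh Hd HF M. apply (matches_sound e st); auto;
    apply in_map_iff in HF; destruct HF as (s & <- & _); cbn [lead tick]; [|lia].
  now apply (holds_heading e st x d f).
Qed.

Lemma settled_sound (e : frame) (st : sym) (x d a : site) (f : site -> rotator) (K : Z) :
  holds e st x d f -> In d directions -> settled K a st = true ->
  exists F, in_phase F x d f /\ K <= gain F (fpt e a).
Proof.
  intros Hh Hd S. apply existsb_exists in S. destruct S as (F & HF & S).
  destruct (matches st F) eqn:M; [|discriminate]. apply Z.leb_le in S.
  exists (fphase e F). split; [now apply (fresh_phases_sound e st)|].
  rewrite gain_fphase; auto. apply Hh.
Qed.

Definition touches (F : phase) (a : site) : Prop := exists o, In (a, o) (phase_conf F).

Lemma harmless_sound (e : frame) (st : sym) (x d a : site) (f : site -> rotator) :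
  holds e st x d f -> In d directions -> harmless a st = true ->
  exists F, in_phase F x d f /\ 12 <= gain F (fpt e a) /\ ~ touches F (fpt e a).
Proof.
  intros Hh Hd S. apply existsb_exists in S. destruct S as (F & HF & S).
  destruct (matches st F) eqn:M; [|discriminate].
  apply andb_true_iff in S. destruct S as (G & N). apply Z.leb_le in G.
  exists (fphase e F). rewrite gain_fphase by apply Hh. split; [|split; auto].
  - apply in_flat_map in HF. destruct HF as (s & _ & HF).
    apply in_flat_map in HF. destruct HF as (j & Hj & HF).
    apply in_map_iff in HF. destruct HF as (u & <- & Hu).
    apply (matches_sound e st); auto; cbn [lead tick].
    + pose proof (holds_heading e st x d f Hh Hd) as H0.
      destruct Hu as [<- | [<- | [<- | []]]]; auto using turn_direction.
    + apply in_seq in Hj. lia.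
  - intros (o & Ho). rewrite phase_conf_fphase in Ho. apply in_map_iff in Ho.
    destruct Ho as (p & E & Hp). apply (f_equal fst) in E. cbn [fst] in E.
    apply fpt_inj in E; [|apply Hh].
    unfold involves in N. apply negb_true_iff in N.
    assert (existsb (fun p => site_eqb a (fst p)) (phase_conf F) = true); [|congruence].
    apply existsb_exists. exists p. split; auto.
    destruct (site_eqb_spec a (fst p)); congruence.
Qed.

(** * A walker in a configuration disturbed from outside *)

(** The particle arrives at [X n] with direction [d n] and finds the rotators [c n]. *)
Record walk (X d : nat -> site) (c : nat -> site -> rotator) : Prop := {
  walk_dir : forall n, In (d n) directions;
  walk_turn : forall n, d (S n) = turn (c n (X n)) (d n);
  walk_move : forall n, X (S n) = vadd (X n) (d (S n))
}.

Lemma walk_sym_step X d c e st n g :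
  walk X d c -> g (X n) = c n (X n) -> holds e st (X n) (d n) g ->
  exists st', In st' (sym_step st) /\ holds e st' (X (S n)) (d (S n)) (upd g (X n)).
Proof.
  intros W G H. apply sym_step_sound in H.
  now rewrite G, <- (walk_turn _ _ _ W), <- (walk_move _ _ _ W) in H.
Qed.

Lemma walk_phase_step X d c F n :
  walk X d c -> in_phase F (X n) (d n) (c n) ->
  exists F', in_phase F' (X (S n)) (d (S n)) (upd (c n) (X n)) /\
    axis F' = axis F /\ level F + 1 <= level F' /\
    (forall p, In p (phase_conf F') -> nearb 20 (fst p) (X n) = true).
Proof.
  intros W H. apply phase_step in H.
  now rewrite <- (walk_turn _ _ _ W), <- (walk_move _ _ _ W) in H.
Qed.

Lemma explore_sound X d c (W : walk X d c) e k : forall st n,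
  explore k st = true -> holds e st (X n) (d n) (c n) ->
  (forall i h, (i < k)%nat -> nearb 20 h (X (n + i)%nat) = true ->
     c (S (n + i)) h = upd (c (n + i)%nat) (X (n + i)%nat) h) ->
  exists i F, (i <= k)%nat /\ in_phase F (X (n + i)%nat) (d (n + i)%nat) (c (n + i)%nat).
Proof.
  induction k as [|k IH]; intros st n; cbn [explore];
    destruct (existsb (matches st) (fresh_phases st)) eqn:B; intros Hx Hh Hc.
  1,3: apply existsb_exists in B; destruct B as (F & HF & M); exists 0%nat, (fphase e F);
    rewrite Nat.add_0_r; split; [lia|]; apply (fresh_phases_sound e st); auto; apply W.
  - discriminate.
  - destruct (walk_sym_step X d c e st n _ W eq_refl Hh) as (st' & Hst & Hh').
    rewrite forallb_forall in Hx. specialize (Hx _ Hst).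
    apply andb_true_iff in Hx. destruct Hx as (Hn & Hx). rewrite forallb_forall in Hn.
    destruct (IH st' (S n) Hx) as (i & F & Hi & HF).
    + revert Hh'. apply holds_ext. intros p Hp.
      specialize (Hc 0%nat (fpt e (fst p))). rewrite Nat.add_0_r in Hc. apply Hc; [lia|].
      rewrite (holds_site _ _ _ _ _ Hh). apply (near_fpt e 10); [apply Hh|auto].
    + intros i h Hi Hnear. specialize (Hc (S i) h). rewrite <- plus_n_Sm in Hc.
      apply Hc; [lia|auto].
    + exists (S i), F. rewrite <- plus_n_Sm. split; [lia|auto].
Qed.

Lemma startup X d c n :
  walk X d c ->
  (forall i h, (i < 9)%nat -> nearb 20 h (X (n + i)%nat) = true ->
     c (S (n + i)) h = upd (c (n + i)%nat) (X (n + i)%nat) h) ->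
  exists i F, (i <= 9)%nat /\ in_phase F (X (n + i)%nat) (d (n + i)%nat) (c (n + i)%nat).
Proof.
  intros W. apply (explore_sound X d c W (Frame (X n) (d n) false) 9 _ n explore_standard).
  constructor; cbn [ex at_site heading known lookup]; [apply W| | |discriminate];
    unfold fpt, fvec, vadd; cbn [org ex fst snd];
    [destruct (X n) | destruct (d n)]; cbn [fst snd]; f_equal; ring.
Qed.

(** The premise excluding outside flips may use whatever is known of the next phase: its level when
    the disturbances fall behind, its nearness to the walker when they are far away. *)
Lemma phase_persist X d c F n N :
  walk X d c -> in_phase F (X n) (d n) (c n) ->
  (forall m F', (n <= m < N)%nat ->
     in_phase F' (X (S m)) (d (S m)) (upd (c m) (X m)) -> axis F' = axis F ->
     level F + Z.of_nat (S m - n) <= level F' ->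
     (forall p, In p (phase_conf F') -> nearb 20 (fst p) (X m) = true) ->
     forall p, In p (phase_conf F') -> c (S m) (fst p) = upd (c m) (X m) (fst p)) ->
  forall m, (n <= m <= N)%nat ->
  exists F', in_phase F' (X m) (d m) (c m) /\ axis F' = axis F /\
    level F + Z.of_nat (m - n) <= level F'.
Proof.
  intros W HF HK m. induction m as [|m IH]; intros Hm.
  - replace n with 0%nat in * by lia. exists F. split; [auto|split; [auto|lia]].
  - destruct (Nat.eq_dec n (S m)) as [E|E].
    + subst n. exists F. split; [auto|split; [auto|lia]].
    + destruct IH as (F1 & H1 & A1 & L1); [lia|].
      destruct (walk_phase_step _ _ _ _ _ W H1) as (F2 & H2 & A2 & L2 & N2).
      exists F2. split; [|split; [congruence|lia]].
      apply (in_phase_ext _ _ _ (upd (c m) (X m))); [|auto].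
      apply HK; auto; [lia|congruence|lia].
Qed.

Definition advancing (X d : nat -> site) (c : nat -> site -> rotator) (w : site) (L : Z)
    (m : nat) : Prop :=
  exists F, in_phase F (X m) (d m) (c m) /\ axis F = w /\ L + Z.of_nat m <= level F.

Lemma solo_advancing X d c K :
  walk X d c ->
  (forall m h, (K <= m)%nat -> nearb 20 h (X m) = true -> c (S m) h = upd (c m) (X m) h) ->
  exists w L M, In w directions /\ forall m, (M <= m)%nat -> advancing X d c w L m.
Proof.
  intros W HK.
  destruct (startup X d c K W) as (j & F & _ & HF); [intros; apply HK; auto; lia|].
  exists (axis F), (level F - Z.of_nat (K + j)), (K + j)%nat.
  split; [apply (axis_direction _ _ _ _ HF)|].
  intros m Hm.
  destruct (phase_persist X d c F (K + j) m W HF) with (m := m) as (F' & H' & A' & L').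
  - intros m' F' Hm' _ _ _ N p Hp. apply HK; [lia|auto].
  - lia.
  - exists F'. split; [auto|split; [auto|lia]].
Qed.

Lemma advancing_unbounded X d c w L M B :
  (forall m, (M <= m)%nat -> advancing X d c w L m) ->
  exists M', forall m, (M' <= m)%nat -> B <= phi w (X m).
Proof.
  (* As [gain F (X m)] is at most 27, [7 * phi w (X m)] is at least [L + m - 27]. *)
  intros H. exists (M + Z.to_nat (7 * B + 27 - L))%nat. intros m Hm.
  destruct (H m) as (F & HF & <- & HL); [lia|].
  apply phase_bounds in HF. unfold gain in HF. lia.
Qed.

(** * Two particles *)

(** The second particle pays its [k]-th visit to [A k], arriving with direction [u k],
    during the interval that starts with visit [i k] of the first particle and ends just
    before the next one. *)
Record pursuit (X d : nat -> site) (c : nat -> site -> rotator) (A u : nat -> site)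
    (i : nat -> nat) : Prop := {
  pursuit_walk : walk X d c;
  pursuit_dir : forall k, In (u k) directions;
  pursuit_turn : forall k, u (S k) = turn (upd (c (i k)) (X (i k)) (A k)) (u k);
  pursuit_move : forall k, A (S k) = vadd (A k) (u (S k));
  pursuit_gap : forall k, (i k + 30 <= i (S k))%nat;
  pursuit_hit : forall k, c (S (i k)) (A k) = flip (upd (c (i k)) (X (i k)) (A k));
  pursuit_clean : forall m h, (i 0%nat <= m)%nat -> (forall k, i k = m -> A k <> h) ->
    c (S m) h = upd (c m) (X m) h
}.

Section Pursuit.

Context {X d : nat -> site} {c : nat -> site -> rotator} {A u : nat -> site} {i : nat -> nat}.
Context (P : pursuit X d c A u i).

Let W : walk X d c := pursuit_walk _ _ _ _ _ _ P.

Lemma visit_gap a b : (a <= b -> i a + 30 * (b - a) <= i b)%nat.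
Proof.
  induction 1 as [|b Hb IH]; [lia|]. pose proof (pursuit_gap _ _ _ _ _ _ P b). lia.
Qed.

Lemma visit_inj a b : i a = i b -> a = b.
Proof.
  intros H. destruct (Nat.lt_trichotomy a b) as [L|[L|L]]; auto;
    [pose proof (visit_gap a b) | pose proof (visit_gap b a)]; lia.
Qed.

Lemma undisturbed k m h : (i k < m < i (S k))%nat -> c (S m) h = upd (c m) (X m) h.
Proof.
  intros H. apply (pursuit_clean _ _ _ _ _ _ P); [pose proof (visit_gap 0 k); lia|].
  intros b E. exfalso. destruct (Nat.le_gt_cases b k) as [L|L];
    [pose proof (visit_gap b k) | pose proof (visit_gap (S k) b)]; lia.
Qed.

Lemma drift w a b : In w directions -> (a <= b)%nat ->
  phi w (A b) <= phi w (A a) + 2 * Z.of_nat (b - a).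
Proof.
  intros Hw. induction 1 as [|b Hb IH]; [lia|].
  rewrite (pursuit_move _ _ _ _ _ _ P).
  pose proof (phi_step w (A b) (u (S b)) Hw (pursuit_dir _ _ _ _ _ _ P _)). lia.
Qed.

(** The configuration at the end of interval [i k] but for the flip at [A k]. *)
Definition before_hit (k : nat) : site -> rotator := upd (c (i k)) (X (i k)).

Definition phase_at_hit (k : nat) (F : phase) : Prop :=
  in_phase F (X (S (i k))) (d (S (i k))) (before_hit k).

Lemma spared k F :
  phase_at_hit k F -> ~ touches F (A k) -> in_phase F (X (S (i k))) (d (S (i k))) (c (S (i k))).
Proof.
  intros H T. revert H. apply in_phase_ext. intros [h o] Hp. cbn [fst].
  apply (pursuit_clean _ _ _ _ _ _ P); [pose proof (visit_gap 0 k); lia|].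
  intros b E. apply visit_inj in E. subst b. intros <-. apply T. now exists o.
Qed.

(** At the last index [c] already contains the flip made by visit [S k], so [before_hit] takes its
    place. *)
Definition fits (k n : nat) (g : site -> rotator) : Prop :=
  ((n <= i (S k))%nat -> forall h, g h = c n h) /\
  (n = S (i (S k)) -> forall h, g h = before_hit (S k) h).

Lemma fits_step k n :
  (i k < n <= i (S k))%nat -> fits k (S n) (upd (c n) (X n)).
Proof.
  intros Hn. split; intros H h.
  - symmetry. apply (undisturbed k). lia.
  - injection H as ->. reflexivity.
Qed.

Lemma phase_until_hit k n g F :
  (i k < n <= S (i (S k)))%nat -> fits k n g -> in_phase F (X n) (d n) g ->
  exists F', phase_at_hit (S k) F' /\ axis F' = axis F /\
    level F + Z.of_nat (S (i (S k)) - n) <= level F'.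
Proof.
  intros Hn [G1 G2] HF. destruct (Nat.eq_dec n (S (i (S k)))) as [->|E].
  - exists F. split; [|split; [auto|lia]]. revert HF. apply in_phase_ext.
    intros. symmetry. now apply G2.
  - assert (HF' : in_phase F (X n) (d n) (c n))
      by (revert HF; apply in_phase_ext; intros; symmetry; apply G1; lia).
    destruct (phase_persist X d c F n (i (S k)) W HF') with (m := i (S k))
      as (F1 & H1 & A1 & L1); [|lia|].
    + intros m F' Hm _ _ _ _ p _. apply (undisturbed k). lia.
    + destruct (walk_phase_step _ _ _ _ _ W H1) as (F2 & H2 & A2 & L2 & _).
      exists F2. split; [auto|split; [congruence|lia]].
Qed.

Lemma sym_step_fits e st k n g :
  (i k < n <= i (S k))%nat -> fits k n g -> holds e st (X n) (d n) g ->
  exists st' g', In st' (sym_step st) /\ fits k (S n) g' /\ holds e st' (X (S n)) (d (S n)) g'.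
Proof.
  intros Hn [G _] H. specialize (G (proj2 Hn)).
  assert (H' : holds e st (X n) (d n) (c n)) by (revert H; apply holds_ext; auto).
  destruct (walk_sym_step _ _ _ _ _ _ _ W eq_refl H') as (st' & Hs & H2).
  exists st', (upd (c n) (X n)). auto using fits_step.
Qed.

(** The level grows by at least one per step, so a gain short of 28 by the number of remaining steps
    reaches 28 at the visit. *)
Lemma settled_until_hit e st k n g K a :
  (i k < n <= S (i (S k)))%nat -> fits k n g -> holds e st (X n) (d n) g ->
  settled K a st = true ->
  exists F, phase_at_hit (S k) F /\
    K + Z.of_nat (S (i (S k)) - n) <= gain F (fpt e a).
Proof.
  intros Hn G H S0.
  destruct (settled_sound e st _ _ a g K H (walk_dir _ _ _ W n) S0) as (F & HF & GF).
  destruct (phase_until_hit k n g F Hn G HF) as (F' & HF' & EA & EL).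
  exists F'. split; [auto|]. unfold gain in *. rewrite EA. lia.
Qed.

Lemma clear_sound e k a visit r : forall st n g,
  clear r a visit st = true -> (i k < n)%nat -> (n + r <= S (i (S k)))%nat ->
  fits k n g -> holds e st (X n) (d n) g ->
  (exists F, phase_at_hit (S k) F /\ 28 <= gain F (fpt e a)) \/
  (exists st' g', visit st' = true /\ fits k (n + r) g' /\
     holds e st' (X (n + r)%nat) (d (n + r)%nat) g').
Proof.
  induction r as [|r IH]; intros st n g; cbn [clear];
    destruct (settled _ a st) eqn:S0; intros C Hn Hr G H.
  1,3: left; edestruct settled_until_hit as (F & HF & GF);
    [| exact G | exact H | exact S0 |]; [lia|]; exists F; split; [auto|lia].
  - right. exists st, g. now rewrite Nat.add_0_r.
  - destruct (sym_step_fits e st k n g) as (st' & g' & Hs & G' & H'); auto; [lia|].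
    rewrite forallb_forall in C.
    rewrite <- plus_n_Sm. apply (IH st' (S n) g'); auto; lia.
Qed.

Lemma wait_sound e k a visit r : forall st n g,
  wait r a visit st = true -> (i k < n <= S (i (S k)))%nat ->
  fits k n g -> holds e st (X n) (d n) g ->
  (exists F, phase_at_hit (S k) F /\ 28 <= gain F (fpt e a)) \/
  (exists st', visit st' = true /\
     holds e st' (X (S (i (S k)))) (d (S (i (S k)))) (before_hit (S k))).
Proof.
  induction r as [|r IH]; intros st n g; cbn [wait];
    destruct (settled _ a st) eqn:S0; intros C Hn G H.
  1,3: left; edestruct settled_until_hit as (F & HF & GF);
    [| exact G | exact H | exact S0 |]; [lia|]; exists F; split; [auto|lia].
  - destruct (visit st); discriminate.
  - destruct (visit st) eqn:V; [|discriminate].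
    destruct (Nat.eq_dec n (S (i (S k)))) as [->|E].
    + right. exists st. split; [auto|]. revert H. apply holds_ext.
      intros. symmetry. now apply G.
    + destruct (sym_step_fits e st k n g) as (st' & g' & Hs & G' & H'); auto; [lia|].
      rewrite forallb_forall in C. apply (IH st' (S n) g'); auto; lia.
Qed.

Definition leaves_behind (k : nat) : Prop :=
  exists F, phase_at_hit k F /\ 12 <= gain F (A k) /\ ~ touches F (A k).

Lemma untouched F k : phase_at_hit k F -> 28 <= gain F (A k) -> ~ touches F (A k).
Proof.
  intros H G (o & Ho). apply phase_bounds in H. apply (proj2 H) in Ho. cbn [fst] in Ho. lia.
Qed.

(** Each disturbing visit uses up one unit of [D]: the execution is followed to the next visit,
    which is either harmless or opens another round. *)
Lemma chase_sound D : forall e st k a v,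
  chase D st a v = true -> A k = fpt e a -> u k = fvec e v ->
  holds e st (X (S (i k))) (d (S (i k))) (before_hit k) ->
  exists k', leaves_behind k'.
Proof.
  induction D as [|D IH]; intros e st k a v C EA EU H; cbn [chase] in C; [discriminate|].
  destruct (lookup a (known st)) as [o|] eqn:L; [|discriminate].
  assert (Eo : before_hit k (A k) = frot e o) by (rewrite EA; now apply H).
  assert (EU' : u (S k) = fvec e (turn o v)).
  { rewrite (pursuit_turn _ _ _ _ _ _ P). fold (before_hit k).
    now rewrite Eo, EU, fvec_turn. }
  assert (EA' : A (S k) = fpt e (vadd a (turn o v))).
  { now rewrite (pursuit_move _ _ _ _ _ _ P), EU', EA, fpt_vadd. }
  cbv zeta in C.
  (* Distinct visits fall in distinct intervals, so visit [k] flips only the rotator at [A k]; its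
     new value, put in front, overrides the old one. *)
  assert (Hst : holds e (Sym (at_site st) (heading st) ((a, flip o) :: known st))
     (X (S (i k))) (d (S (i k))) (c (S (i k)))).
  { destruct H as [H1 H2 H3 H4]. constructor; auto.
    cbn [known lookup]. intros h o' Ho.
    destruct (site_eqb_spec h a) as [->|N].
    - injection Ho as <-. rewrite <- EA, (pursuit_hit _ _ _ _ _ _ P). fold (before_hit k).
      now rewrite Eo, frot_flip.
    - rewrite <- (H4 h o' Ho).
      apply (pursuit_clean _ _ _ _ _ _ P); [pose proof (visit_gap 0 k); lia|].
      intros b Hb. apply visit_inj in Hb. subst b. rewrite EA. intros E.
      apply fpt_inj in E; auto. }
  pose proof (pursuit_gap _ _ _ _ _ _ P k) as Hgap.
  assert (Done : (exists F, phase_at_hit (S k) F /\ 28 <= gain F (fpt e (vadd a (turn o v)))) ->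
     exists k', leaves_behind k').
  { intros (F & HF & GF). rewrite <- EA' in GF. exists (S k), F.
    split; [auto|]. split; [lia|]. now apply untouched. }
  apply (clear_sound e k) with (n := S (i k)) (g := c (S (i k))) in C; auto; try lia.
  - destruct C as [C | (st' & g' & V & G' & H')]; [auto|].
    apply (wait_sound e k) with (3 := G') in V; auto; [|lia].
    destruct V as [V | (st2 & V & H2)]; [auto|].
    destruct (harmless (vadd a (turn o v)) st2) eqn:Q.
    + apply (harmless_sound e) with (1 := H2) in Q; [|apply W].
      rewrite <- EA' in Q. now exists (S k).
    + apply (IH e st2 (S k) _ _ V); auto.
  - split; [auto|lia].
Qed.

(** The nine start-up steps fit between visits 0 and 1, which are at least 30 steps apart. *)
Lemma first_phase : exists F, phase_at_hit 1 F.
Proof.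
  pose proof (pursuit_gap _ _ _ _ _ _ P 0) as H.
  destruct (startup X d c (S (i 0%nat)) W) as (j & F & Hj & HF).
  - intros j h Hj _. apply (undisturbed 0). lia.
  - destruct (phase_until_hit 0 (S (i 0%nat) + j) (c (S (i 0%nat) + j)%nat) F)
      as (F' & HF' & _); [lia|split; [auto|lia]|auto|now exists F'].
Qed.

(** * Permanent advance of the fast particle *)

Lemma leaves_behind_advancing k :
  leaves_behind k ->
  exists w L M, In w directions /\ forall m, (M <= m)%nat -> advancing X d c w L m.
Proof.
  intros (F & HF & GF & TF).
  exists (axis F), (level F - Z.of_nat (S (i k))), (S (i k)).
  pose proof (axis_direction _ _ _ _ HF) as Hw. split; [auto|].
  intros m Hm. apply spared in HF; auto.
  destruct (phase_persist X d c F (S (i k)) m W HF) with (m := m) as (F' & H' & A' & L').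
  - intros m' F' Hm' H' A' L' _ [h o] Hp. cbn [fst].
    apply (pursuit_clean _ _ _ _ _ _ P); [pose proof (visit_gap 0 k); lia|].
    intros b Hb <-. subst m'.
    assert (k < b)%nat
      by (destruct (Nat.le_gt_cases b k); [pose proof (visit_gap b k); lia | auto]).
    pose proof (visit_gap k b). pose proof (drift (axis F) k b Hw).
    (* The gain over [A b] is at least [12 + (30 - 14) * (b - k)], hence at least 28, where 14 is 7
       times the drift of 2 per visit. *)
    apply (untouched F' b H'); [|now exists o].
    unfold gain in *. rewrite A'. lia.
  - lia.
  - exists F'. split; [auto|split; [auto|lia]].
Qed.

(** Either some visit touches a phase, and the exhaustive chase leads to a harmless visit; or none
    ever does, and the phase present at visit 1 lasts forever. *)
Lemma pursuit_advancing :
  exists w L M, In w directions /\ forall m, (M <= m)%nat -> advancing X d c w L m.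
Proof.
  destruct (classic (exists k F, phase_at_hit k F /\ touches F (A k))) as [(k & F & HF & o & Ho)|N].
  - destruct (phase_standard F) as (e & EF & Ee).
    assert (He : In (ex e) directions) by (rewrite Ee; apply HF).
    pose proof (in_phase_tick _ _ _ _ HF) as Ht. set (j := tick F) in *. clearbody j.
    subst F. rewrite phase_conf_fphase in Ho. apply in_map_iff in Ho.
    destruct Ho as ([a o'] & E & Ha). apply (f_equal fst) in E. cbn [fst] in E. rename E into EA.
    destruct (fvec_onto e (u k) He (pursuit_dir _ _ _ _ _ _ P k)) as (v & Hv & EU).
    destruct (chase_sound 5 e (start (standard j)) k a v) as (k' & Hk'); auto.
    + now apply (chase_standard j a v o').
    + now apply start_sound.
    + now apply (leaves_behind_advancing k').
  - destruct first_phase as (F & HF).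
    exists (axis F), (level F - Z.of_nat (S (i 1%nat))), (S (i 1%nat)).
    split; [apply (axis_direction _ _ _ _ HF)|].
    intros m Hm. apply spared in HF; [|now intros T; apply N; exists 1%nat, F].
    destruct (phase_persist X d c F (S (i 1%nat)) m W HF) with (m := m) as (F' & H' & A' & L').
    + intros m' F' Hm' H' A' L' _ [h o] Hp. cbn [fst].
      apply (pursuit_clean _ _ _ _ _ _ P); [pose proof (visit_gap 0 1); lia|].
      intros b Hb <-. subst m'. apply N. exists b, F'. split; [auto|now exists o].
    + lia.
    + exists F'. split; [auto|split; [auto|lia]].
Qed.

Lemma phi_near w x y r : In w directions -> nearb r x y = true -> phi w x <= phi w y + 6 * r.
Proof.
  unfold nearb. rewrite andb_true_iff, !Z.leb_le. intros Hw.
  case_direction Hw; subst w; unfold phi; cbn [fst snd]; lia.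
Qed.

Lemma pursuit_far :
  exists K, forall k n, (K <= k)%nat -> (i k <= n)%nat -> nearb 20 (X n) (A k) = false.
Proof.
  destruct pursuit_advancing as (w & L & M & Hw & H).
  (* 900 exceeds [7 * 6 * 20 + 27], the allowance for nearness plus the bound on the gain. Per visit
     the level grows by at least 30 and [7 * phi w (A k)] by at most 14. *)
  exists (M + Z.to_nat (900 + 7 * phi w (A 0%nat) - L))%nat. intros k n Hk Hn.
  destruct (nearb 20 (X n) (A k)) eqn:N; [exfalso|auto].
  apply (phi_near w) in N; auto.
  pose proof (drift w 0 k Hw). pose proof (visit_gap 0 k).
  destruct (H n) as (F & HF & <- & HL); [lia|].
  apply phase_bounds in HF. unfold gain in HF. lia.
Qed.

End Pursuit.

(** * Continuous time *)

Open Scope R_scope.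

Lemma site_pos_vadd (x y : site) : site_pos (vadd x y) = Cplus (site_pos x) (site_pos y).
Proof.
  unfold site_pos, vadd, Cplus. cbn [fst snd]. rewrite !plus_IZR. f_equal; field.
Qed.

Lemma site_pos_vsub (x y : site) : site_pos (vsub x y) = Cminus (site_pos x) (site_pos y).
Proof.
  unfold site_pos, vsub, Cminus, Cplus, Copp. cbn [fst snd]. rewrite !minus_IZR. f_equal; field.
Qed.

Lemma sqrt3_pos : 0 < sqrt 3.
Proof. apply sqrt_lt_R0. lra. Qed.

Lemma site_pos_line (x d h : site) (r : R) :
  Cplus (site_pos x) (Cmult (RtoC r) (site_pos d)) = site_pos h ->
  r * IZR (fst d) = IZR (fst h - fst x) /\ r * IZR (snd d) = IZR (snd h - snd x).
Proof.
  intros E. unfold site_pos, Cplus, Cmult, RtoC in E. cbn [fst snd] in E.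
  injection E as E1 E2. rewrite !minus_IZR. pose proof sqrt3_pos.
  assert (E3 : IZR (snd x) + r * IZR (snd d) = IZR (snd h)).
  { apply (Rmult_eq_reg_r (sqrt 3 / 2)); [|lra]. rewrite <- E2. field. }
  split; [|lra]. nra.
Qed.

Lemma site_pos_inj (x y : site) : site_pos x = site_pos y -> x = y.
Proof.
  intros E. destruct (site_pos_line x (0, 0)%Z y 0) as (H1 & H2).
  - rewrite <- E. apply injective_projections; simpl; ring.
  - rewrite Rmult_0_l in H1, H2. apply eq_IZR in H1, H2.
    destruct x, y; simpl in *. f_equal; lia.
Qed.

(** Some coordinate of [d] is 1 or -1, so a site there would make [r] an integer. *)
Lemma not_site_on_bond (x d : site) (r : R) :
  In d directions -> 0 < r < 1 ->
  ~ is_site (Cplus (site_pos x) (Cmult (RtoC r) (site_pos d))).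
Proof.
  intros Hd Hr (h & E). apply site_pos_line in E. destruct E as (E1 & E2).
  assert (N : forall z, 0 < IZR z < 1 -> False).
  { intros z [H1 H2]. apply lt_IZR in H1, H2. lia. }
  assert (N' : forall z, r * 1 = IZR z -> False) by (intros z Hz; apply (N z); lra).
  assert (N2 : forall z, r * -1 = IZR z -> False).
  { intros z Hz. apply (N (- z)%Z). rewrite opp_IZR. lra. }
  case_direction Hd; subst d; cbn [fst snd] in *; eauto.
Qed.

Lemma adjacent_direction (h k : site) : adjacent h k -> In (vsub k h) directions.
Proof.
  unfold adjacent. rewrite <- site_pos_vsub. destruct (vsub k h) as [p q].
  intros E. unfold Cmod, site_pos in E. cbn [fst snd] in E.
  apply (f_equal (fun x => x * x)) in E. cbv beta in E.
  rewrite sqrt_sqrt in E by (apply Rplus_le_le_0_compat; apply pow2_ge_0).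
  assert (S3 : sqrt 3 * sqrt 3 = 3) by (apply sqrt_sqrt; lra).
  assert (H : IZR (p * p + p * q + q * q) = IZR 1).
  { rewrite !plus_IZR, !mult_IZR. nra. }
  apply eq_IZR in H.
  assert (Hp : (-1 <= p <= 1)%Z) by nia. assert (Hq : (-1 <= q <= 1)%Z) by nia.
  assert (p = -1 \/ p = 0 \/ p = 1)%Z as [-> | [-> | ->]] by lia;
    assert (q = -1 \/ q = 0 \/ q = 1)%Z as [-> | [-> | ->]] by lia;
    try discriminate H; simpl; tauto.
Qed.

Lemma Cmod_direction (d : site) : In d directions -> Cmod (site_pos d) = 1.
Proof.
  assert (S3 : sqrt 3 * sqrt 3 = 3) by (apply sqrt_sqrt; lra).
  intros Hd. unfold Cmod. rewrite <- sqrt_1. f_equal.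
  case_direction Hd; subst d; unfold site_pos; cbn [fst snd]; nra.
Qed.

Lemma scatter_site_pos (o : rotator) (r : R) (d : site) :
  scatter o (Cmult (RtoC r) (site_pos d)) = Cmult (RtoC r) (site_pos (turn o d)).
Proof.
  assert (S3 : sqrt 3 * sqrt 3 = 3) by (apply sqrt_sqrt; lra).
  assert (HC : cos (2 * PI / 3) = -1 / 2)
    by (rewrite <- cos_2PI3; f_equal; field).
  assert (HS : sin (2 * PI / 3) = sqrt 3 / 2)
    by (rewrite <- sin_2PI3; f_equal; field).
  unfold scatter, rotate, site_pos, Cmult, RtoC.
  destruct o; cbn [turn fst snd]; rewrite ?cos_neg, ?sin_neg, HC, HS;
    rewrite !minus_IZR, ?opp_IZR; f_equal; field [S3].
Qed.

(** Cauchy-Schwarz for the unit vector [w]; the defect of the squares is three times the square of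
    [p], [q] or [p + q]. *)
Lemma phi_le_Cmod (w x : site) : In w directions -> IZR (phi w x) <= 2 * Cmod (site_pos x).
Proof.
  intros Hw. destruct x as [p q].
  assert (S3 : sqrt 3 * sqrt 3 = 3) by (apply sqrt_sqrt; lra).
  assert (HN : Cmod (site_pos (p, q)) * Cmod (site_pos (p, q))
     = IZR p * IZR p + IZR p * IZR q + IZR q * IZR q).
  { unfold Cmod. rewrite sqrt_sqrt by (apply Rplus_le_le_0_compat; apply pow2_ge_0).
    unfold site_pos. cbn [fst snd]. nra. }
  pose proof (Cmod_ge_0 (site_pos (p, q))) as H0.
  apply Rnot_lt_le. intros H. revert H HN.
  generalize dependent (Cmod (site_pos (p, q))). intros m Hm H HN.
  assert (H0 : 2 * m * (2 * m) < IZR (phi w (p, q)) * IZR (phi w (p, q)))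
    by (apply Rmult_le_0_lt_compat; lra).
  pose proof (Rle_0_sqr (IZR p)) as Hp. pose proof (Rle_0_sqr (IZR q)) as Hq.
  pose proof (Rle_0_sqr (IZR p + IZR q)) as Hpq. unfold Rsqr in *.
  case_direction Hw; subst w; unfold phi in *; cbn [fst snd] in *;
    rewrite ?opp_IZR, ?plus_IZR, ?mult_IZR in H0; nra.
Qed.

(** From time [T] on, particle [j] is at the site [X n] exactly at time [T + n * tau],
    where it arrives with direction [d n]. *)
Record itinerary (E : history 2) (j : Fin.t 2) (T tau : R) (X d : nat -> site) : Prop := {
  it_start : 0 <= T;
  it_tau : 0 < tau;
  it_dir : forall n, In (d n) directions;
  it_turn : forall n, d (S n) = turn (conf E (T + INR n * tau) (X n)) (d n);
  it_move : forall n, X (S n) = vadd (X n) (d (S n));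
  it_at : forall n, Defs.pos E j (T + INR n * tau) = site_pos (X n);
  it_visits : forall t h, T <= t -> Defs.pos E j t = site_pos h ->
    exists n, t = T + INR n * tau /\ h = X n;
  it_near : forall t, T <= t ->
    exists n, T + INR n * tau <= t < T + (INR n + 1) * tau /\
      Cmod (Cminus (Defs.pos E j t) (site_pos (X n))) <= 1
}.

(** * From continuous motion to itineraries *)

Lemma clock (T tau t : R) : 0 < tau -> T <= t ->
  {n : nat | T + INR n * tau <= t < T + (INR n + 1) * tau}.
Proof.
  intros Ht H. destruct (nfloor_ex ((t - T) / tau)) as (n & H1 & H2).
  - apply Rmult_le_pos; [lra|]. left. now apply Rinv_0_lt_compat.
  - exists n. assert (E : t = T + (t - T) / tau * tau) by (field; lra).
    rewrite E. split; nra.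
Qed.

Fixpoint run (E : history 2) (T tau : R) (x d : site) (n : nat) : site * site :=
  match n with
  | O => (x, d)
  | S n => let (x, d) := run E T tau x d n in
           let d' := turn (conf E (T + INR n * tau) x) d in (vadd x d', d')
  end.

Section Motion.

Context (I : initial_condition 2) (E : history 2) (HE : evolution I E).

Lemma flight (j : Fin.t 2) (s r : R) (x d : site) :
  0 <= s -> 0 < r -> In d directions ->
  Defs.pos E j s = site_pos x -> vel E j s = Cmult (RtoC r) (site_pos d) ->
  forall t, s < t <= s + / r ->
  let d' := turn (conf E s x) d in
  Defs.pos E j t = Cplus (site_pos x) (Cmult (RtoC ((t - s) * r)) (site_pos d')) /\
  vel E j t = Cmult (RtoC r) (site_pos d').
Proof.
  intros Hs Hr Hd Hp Hv t Ht d'.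
  assert (Hd' : In d' directions) by now apply turn_direction.
  assert (R : forall u, Cmult (RtoC u) (Cmult (RtoC r) (site_pos d'))
     = Cmult (RtoC (u * r)) (site_pos d')).
  { intros u. rewrite Cmult_assoc, RtoC_mult. reflexivity. }
  assert (Hinv : / r * r = 1) by (field; lra).
  destruct (evol_flight _ _ HE j s t (Cmult (RtoC r) (site_pos d'))) as (H1 & H2).
  - lra.
  - left. exists x. split; auto. rewrite Hv. symmetry. apply scatter_site_pos.
  - intros u Hu. rewrite Hp, R. apply not_site_on_bond; auto. nra.
  - rewrite Hp, R in H1. auto.
Qed.

Lemma arrival (j : Fin.t 2) :
  exists T r x d, 0 <= T /\ 0 < r /\ Cmod (init_vel I j) = r /\ In d directions /\
    Defs.pos E j T = site_pos x /\ vel E j T = Cmult (RtoC r) (site_pos d).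
Proof.
  destruct (init_on_bonds _ I j) as (h & k & Hadj & (l & Hl & Hx) & (r & Hr & Hw)).
  pose proof (adjacent_direction h k Hadj) as Hd.
  rewrite <- site_pos_vsub in Hx, Hw. set (d := vsub k h) in *.
  assert (Hk : site_pos k = Cplus (site_pos h) (site_pos d)).
  { unfold d. rewrite site_pos_vsub. apply injective_projections; simpl; ring. }
  assert (Hm : Cmod (init_vel I j) = r).
  { rewrite Hw, Cmod_mult, Cmod_R, Cmod_direction, Rabs_pos_eq; auto; lra. }
  rewrite <- (evol_pos0 _ _ HE) in Hx. pose proof Hw as Hw'. rewrite <- (evol_vel0 _ _ HE) in Hw'.
  (* At either end of the bond the particle counts as arriving there at time 0; otherwise it reaches
     [k] at time [(1 - l) * / r]. *)
  destruct (Req_dec l 0) as [->|N0]; [|destruct (Req_dec l 1) as [->|N1]].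
  - exists 0, r, h, d. repeat split; auto; [lra|].
    rewrite Hx. apply injective_projections; simpl; ring.
  - exists 0, r, k, d. repeat split; auto; [lra|].
    rewrite Hx, Hk. apply injective_projections; simpl; ring.
  - assert (Hinv : / r * r = 1) by (field; lra).
    assert (Hrp : 0 < / r) by now apply Rinv_0_lt_compat.
    assert (HT : 0 < (1 - l) * / r) by (apply Rmult_lt_0_compat; lra).
    assert (R : forall u, Cplus (Defs.pos E j 0) (Cmult (RtoC u) (vel E j 0))
        = Cplus (site_pos h) (Cmult (RtoC (l + u * r)) (site_pos d))).
    { intros u. rewrite Hx, Hw'. apply injective_projections; simpl; ring. }
    destruct (evol_flight _ _ HE j 0 ((1 - l) * / r) (vel E j 0)) as (H1 & H2).
    + lra.
    + right. split; auto. rewrite Hx. apply not_site_on_bond; auto. lra.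
    + intros u Hu. rewrite Rminus_0_r, R. apply not_site_on_bond; auto.
      assert (u * r < (1 - l) * / r * r) by (apply Rmult_lt_compat_r; lra).
      rewrite Rmult_assoc, Hinv in H. split; [|lra].
      assert (0 < u * r) by (apply Rmult_lt_0_compat; lra). lra.
    + exists ((1 - l) * / r), r, k, d. repeat split; auto; [lra| |congruence].
      rewrite H1, Rminus_0_r, R, Hk.
      replace (l + (1 - l) * / r * r) with 1 by (rewrite Rmult_assoc, Hinv; ring).
      apply injective_projections; simpl; ring.
Qed.

Lemma itinerary_exists (j : Fin.t 2) :
  exists T X d, 0 < Cmod (init_vel I j) /\ itinerary E j T (/ Cmod (init_vel I j)) X d.
Proof.
  destruct (arrival j) as (T & r & x & d & HT & Hr & Hm & Hd & Hp & Hv).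
  rewrite Hm. set (tau := / r).
  assert (Htau : 0 < tau) by now apply Rinv_0_lt_compat.
  assert (Hrt : tau * r = 1) by (unfold tau; field; lra).
  set (X := fun n => fst (run E T tau x d n)). set (D := fun n => snd (run E T tau x d n)).
  assert (Hturn : forall n, D (S n) = turn (conf E (T + INR n * tau) (X n)) (D n)).
  { intros n. unfold D, X. cbn [run]. now destruct (run E T tau x d n). }
  assert (Hmove : forall n, X (S n) = vadd (X n) (D (S n))).
  { intros n. unfold D, X. cbn [run]. now destruct (run E T tau x d n). }
  assert (Hdir : forall n, In (D n) directions).
  { induction n as [|n IH]; [exact Hd|]. rewrite Hturn. now apply turn_direction. }
  assert (Hpos : forall n, 0 <= INR n * tau)
    by (intros n; apply Rmult_le_pos; [apply pos_INR | lra]).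
  assert (Hstate : forall n, Defs.pos E j (T + INR n * tau) = site_pos (X n) /\
     vel E j (T + INR n * tau) = Cmult (RtoC r) (site_pos (D n))).
  { induction n as [|n [IH1 IH2]].
    - simpl INR. rewrite Rmult_0_l, Rplus_0_r. auto.
    - pose proof (Hpos n).
      destruct (flight j (T + INR n * tau) r (X n) (D n)) with (t := T + INR (S n) * tau)
        as (F1 & F2); auto; [lra| |].
      + rewrite S_INR. fold tau. lra.
      + rewrite <- Hturn in F1, F2. split; auto.
        rewrite F1, Hmove, site_pos_vadd, S_INR.
        replace ((T + (INR n + 1) * tau - (T + INR n * tau)) * r) with (tau * r) by ring.
        rewrite Hrt.
        now rewrite Cmult_1_l. }
  assert (Hfly : forall n t, T + INR n * tau < t < T + (INR n + 1) * tau ->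
     0 < (t - (T + INR n * tau)) * r < 1 /\
     Defs.pos E j t = Cplus (site_pos (X n))
       (Cmult (RtoC ((t - (T + INR n * tau)) * r)) (site_pos (D (S n))))).
  { intros n t Ht. pose proof (Hpos n). split; [nra|]. rewrite Hturn.
    apply flight; auto; [lra|apply Hstate|apply Hstate|]. fold tau. lra. }
  exists T, X, D. split; auto. constructor; auto.
  - intros n. apply Hstate.
  - intros t h Ht Hh. destruct (clock T tau t Htau Ht) as (n & H1 & H2).
    destruct H1 as [H1|H1].
    + exfalso. destruct (Hfly n t) as (F1 & F2); [lra|].
      rewrite F2 in Hh. apply (not_site_on_bond (X n) (D (S n)) _ (Hdir (S n)) F1).
      now exists h.
    + exists n. split; auto. apply site_pos_inj. rewrite <- Hh, <- H1. apply Hstate.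
  - intros t Ht. destruct (clock T tau t Htau Ht) as (n & H1 & H2).
    exists n. split; auto. destruct H1 as [H1|H1].
    + destruct (Hfly n t) as (F1 & F2); [lra|]. rewrite F2.
      replace (Cminus _ _) with
        (Cmult (RtoC ((t - (T + INR n * tau)) * r)) (site_pos (D (S n))))
        by (apply injective_projections; simpl; ring).
      rewrite Cmod_mult, Cmod_R, Cmod_direction, Rabs_pos_eq; auto; lra.
    + rewrite <- H1, (proj1 (Hstate n)).
      replace (Cminus _ _) with (RtoC 0) by (apply injective_projections; simpl; ring).
      rewrite Cmod_0. lra.
Qed.

End Motion.

(** * Visit times and escape *)

Lemma tick_lt (T tau : R) (m n : nat) :
  0 < tau -> T + INR m * tau < T + INR n * tau -> (m < n)%nat.
Proof. intros Ht H. apply INR_lt. apply (Rmult_lt_reg_r tau); lra. Qed.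

Lemma tick_le (T tau : R) (m n : nat) :
  0 < tau -> (m <= n)%nat -> T + INR m * tau <= T + INR n * tau.
Proof. intros Ht H. apply le_INR in H. nra. Qed.

Lemma escapes_of_unbounded (E : history 2) (j : Fin.t 2) (T tau : R) (X d : nat -> site)
    (w : site) :
  itinerary E j T tau X d -> In w directions ->
  (forall B, exists M, forall m, (M <= m)%nat -> (B <= phi w (X m))%Z) -> escapes E j.
Proof.
  intros H Hw HB. apply is_lim_spec. intros B.
  (* [phi] is at most twice the norm, and the particle is within 1 of the site [X n]; so the norm of
     its position exceeds [B]. *)
  destruct (HB (up (2 * B + 2))) as (M & HM).
  exists (T + INR M * tau). intros t Ht.
  pose proof (it_tau _ _ _ _ _ _ H) as Htau.
  assert (0 <= INR M * tau) by (apply Rmult_le_pos; [apply pos_INR|lra]).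
  destruct (it_near _ _ _ _ _ _ H t) as (n & Hn & HC); [lra|].
  rewrite <- S_INR in Hn.
  assert (Mn : (M < S n)%nat) by (apply (tick_lt T tau); lra).
  assert (HX : (up (2 * B + 2) <= phi w (X n))%Z) by (apply HM; lia).
  apply IZR_le in HX. destruct (archimed (2 * B + 2)) as (U & _).
  pose proof (phi_le_Cmod w (X n) Hw).
  pose proof (Cmod_triangle (Defs.pos E j t)
    (Copp (Cminus (Defs.pos E j t) (site_pos (X n))))) as HT.
  rewrite Cmod_opp in HT.
  replace (Cplus _ _) with (site_pos (X n)) in HT
    by (apply injective_projections; simpl; ring).
  lra.
Qed.

(** * Rotators between consecutive visits of one particle *)

Section Meetings.

Context (I : initial_condition 2) (E : history 2) (HE : evolution I E).
Context (Hsep : no_simultaneous_visits E).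
Context (j j' : Fin.t 2) (Hj : forall i, i = j \/ i = j').
Context {T tau : R} {X d : nat -> site} (H : itinerary E j T tau X d).

Let Htau : 0 < tau := it_tau _ _ _ _ _ _ H.

Lemma tick_ge0 n : 0 <= INR n * tau.
Proof. apply Rmult_le_pos; [apply pos_INR|]. apply Rlt_le, Htau. Qed.

Lemma no_visit_within n t h :
  T + INR n * tau < t < T + INR (S n) * tau -> Defs.pos E j t <> site_pos h.
Proof.
  intros Ht Hp. pose proof (tick_ge0 n).
  destruct (it_visits _ _ _ _ _ _ H t h) as (m & -> & _); auto; [lra|].
  destruct Ht as [H1 H2]. apply tick_lt in H1, H2; auto. lia.
Qed.

(** Used in both roles: with [j] the fast particle it gives the pursuit, with [j] the slow one its
    solitary walk once the other is far. *)
Lemma conf_within n t h :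
  T + INR n * tau < t <= T + INR (S n) * tau ->
  (forall v, T + INR n * tau <= v < t -> Defs.pos E j' v <> site_pos h) ->
  conf E t h = upd (conf E (T + INR n * tau)) (X n) h.
Proof.
  intros Ht Hv. set (s := T + INR n * tau) in *.
  assert (Hs : 0 <= s).
  { pose proof (tick_ge0 n). pose proof (it_start _ _ _ _ _ _ H). unfold s. lra. }
  assert (Hnot : forall v, s < v < t -> ~ visited E v h).
  { intros v Hvt [i Hi]. destruct (Hj i) as [-> | ->].
    - revert Hi. apply (no_visit_within n). fold s. lra.
    - revert Hi. apply Hv. lra. }
  unfold upd. destruct (site_eqb_spec h (X n)) as [->|Hne].
  - apply (evol_flip _ _ HE); auto; [lra|].
    exists j. apply (it_at _ _ _ _ _ _ H).
  - apply (evol_keep _ _ HE); [lra|]. intros v Hvt.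
    destruct (Req_dec v s) as [->|]; [|apply Hnot; lra].
    intros [i Hi]. destruct (Hj i) as [-> | ->].
    + apply Hne, site_pos_inj. rewrite <- Hi. apply (it_at _ _ _ _ _ _ H).
    + revert Hi. apply Hv. lra.
Qed.

Lemma conf_meeting n v h :
  j' <> j -> T + INR n * tau <= v < T + INR (S n) * tau -> Defs.pos E j' v = site_pos h ->
  (forall v', T + INR n * tau <= v' < T + INR (S n) * tau ->
     Defs.pos E j' v' = site_pos h -> v' = v) ->
  conf E v h = upd (conf E (T + INR n * tau)) (X n) h /\
  conf E (T + INR (S n) * tau) h = flip (upd (conf E (T + INR n * tau)) (X n) h).
Proof.
  intros Hne Hv Hp Huniq. set (s := T + INR n * tau) in *.
  assert (Hs : 0 <= s).
  { pose proof (tick_ge0 n). pose proof (it_start _ _ _ _ _ _ H). unfold s. lra. }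
  assert (EV : conf E v h = upd (conf E s) (X n) h).
  { destruct (Req_dec v s) as [->|Nv].
    (* When both particles are at sites at the same instant, separation rules out [h = X n]. *)
    - unfold upd. destruct (site_eqb_spec h (X n)) as [->|]; auto.
      exfalso. apply Hne. apply (Hsep s j' j (X n)); auto. apply (it_at _ _ _ _ _ _ H).
    - apply conf_within; [fold s; lra|]. fold s. intros v' Hv' Hp'.
      apply Huniq in Hp'; lra. }
  split; auto. rewrite <- EV. apply (evol_flip _ _ HE); [lra| |now exists j'].
  intros v' Hv' [i Hi]. destruct (Hj i) as [-> | ->].
  - revert Hi. apply (no_visit_within n). fold s. lra.
  - apply Huniq in Hi; lra.
Qed.

End Meetings.

(** * Combining the two itineraries *)

Lemma particles (i : Fin.t 2) : i = p1 \/ i = p2.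
Proof.
  apply (Fin.caseS' i); [now left|]. intros k. right.
  apply (Fin.caseS' k); [reflexivity|]. intros k'. now apply Fin.case0.
Qed.

Lemma two_particles (I : initial_condition 2) (E : history 2) (HE : evolution I E)
    (Hsep : no_simultaneous_visits E) T tau X d S0 sigma Y v :
  itinerary E p1 T tau X d -> itinerary E p2 S0 sigma Y v -> 30 * tau <= sigma ->
  escapes E p1 /\ escapes E p2.
Proof.
  intros H1 H2 Hsig.
  pose proof (it_tau _ _ _ _ _ _ H1) as Htau. pose proof (it_tau _ _ _ _ _ _ H2) as Hsigma.
  assert (Np : p2 <> p1) by discriminate.
  (* Visits of the slow particle are renumbered from [K], the first one later than both [S0] and
     [T]. *)
  destruct (clock S0 sigma (Rmax S0 T) Hsigma (Rmax_l _ _)) as (k0 & _ & Hk0).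
  rewrite <- S_INR in Hk0. set (K := S k0) in *.
  pose proof (Rmax_r S0 T) as HmT. pose proof (Rmax_l S0 T) as HmS.
  assert (Hlate : forall k, T <= S0 + INR (k + K) * sigma).
  { intros k. pose proof (tick_le S0 sigma K (k + K) Hsigma ltac:(lia)). lra. }
  set (i := fun k => proj1_sig (clock T tau (S0 + INR (k + K) * sigma) Htau (Hlate k))).
  assert (Hi : forall k, T + INR (i k) * tau <= S0 + INR (k + K) * sigma < T + INR (S (i k)) * tau).
  { intros k. rewrite S_INR. unfold i. now destruct clock. }
  set (A := fun k => Y (k + K)%nat). set (u := fun k => v (k + K)%nat).
  set (c := fun n => conf E (T + INR n * tau)).
  assert (Hstep : forall k, S0 + INR (S k + K) * sigma = S0 + INR (k + K) * sigma + sigma).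
  { intros k. rewrite Nat.add_succ_l, S_INR. ring. }
  assert (Hadd : forall n m, T + INR (n + m) * tau = T + INR n * tau + INR m * tau).
  { intros n m. rewrite plus_INR. ring. }
  (* The speed ratio enters here: one period of the slow particle spans at least thirty of the fast
     one. *)
  assert (Hgap : forall k, (i k + 30 <= i (S k))%nat).
  { intros k. apply Nat.lt_succ_r, (tick_lt T tau); auto.
    rewrite Hadd. pose proof (Hi k). pose proof (Hi (S k)). rewrite Hstep in *.
    replace (INR 30) with 30 by (simpl; ring). lra. }
  assert (Hvis : forall t h, T + INR (i 0%nat) * tau <= t -> Defs.pos E p2 t = site_pos h ->
      exists k, t = S0 + INR (k + K) * sigma /\ h = A k).
  { intros t h Ht Hp. pose proof (Hi 0%nat) as Hi0. rewrite S_INR in Hi0. cbn [Nat.add] in Hi0.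
    destruct (it_visits _ _ _ _ _ _ H2 t h) as (n & -> & ->); auto.
    - unfold K in Hi0. rewrite S_INR in Hi0.
      assert (0 <= INR k0 * sigma) by (apply Rmult_le_pos; [apply pos_INR|lra]). lra.
    (* Visit [k0] comes [sigma], which exceeds [tau], before visit [K], so it precedes the interval
       [i 0]. *)
    - assert (k0 < n)%nat.
      { apply (tick_lt S0 sigma); auto. unfold K in Hi0. rewrite S_INR in Hi0. lra. }
      exists (n - K)%nat. unfold A, K. replace (n - S k0 + S k0)%nat with n by lia. auto. }
  assert (Hindex : forall k n, T + INR n * tau <= S0 + INR (k + K) * sigma < T + INR (S n) * tau ->
      i k = n).
  { intros k n Hn. pose proof (Hi k).
    assert (i k < S n)%nat by (apply (tick_lt T tau); lra).
    assert (n < S (i k))%nat by (apply (tick_lt T tau); lra). lia. }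
  assert (Hfrom : forall k, T + INR (i 0%nat) * tau <= T + INR (i k) * tau).
  { intros k. apply tick_le; auto. induction k as [|k IH]; [lia|]. pose proof (Hgap k). lia. }
  assert (Hmeet : forall k,
      conf E (S0 + INR (k + K) * sigma) (A k) = upd (c (i k)) (X (i k)) (A k) /\
      c (S (i k)) (A k) = flip (upd (c (i k)) (X (i k)) (A k))).
  { intros k. apply (conf_meeting I E HE Hsep p1 p2 particles H1); auto.
    - apply (it_at _ _ _ _ _ _ H2).
    - intros t Ht Hp. pose proof (Hfrom k).
      destruct (Hvis t (A k)) as (k' & -> & _); auto; [lra|].
      apply Hindex in Ht.
      destruct (Nat.lt_trichotomy k k') as [L|[->|L]]; auto; exfalso;
        (assert (Hmon : forall a b, (a < b)%nat -> (i a < i b)%nat)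
          by (induction 1 as [|b Hb IH];
              [pose proof (Hgap a) | pose proof (Hgap b)]; lia));
        apply Hmon in L; lia. }
  assert (P : pursuit X d c A u i).
  { constructor; auto.
    - constructor; apply H1.
    - intros k. apply (it_dir _ _ _ _ _ _ H2).
    - intros k. rewrite <- (proj1 (Hmeet k)). apply (it_turn _ _ _ _ _ _ H2).
    - intros k. apply (it_move _ _ _ _ _ _ H2).
    - intros k. apply Hmeet.
    - intros m h Hm Hk. unfold c.
      apply (conf_within I E HE p1 p2 particles H1).
      + rewrite S_INR. lra.
      + intros t Ht Hp. pose proof (tick_le T tau _ _ Htau Hm).
        destruct (Hvis t h) as (k & -> & ->); auto; [lra|].
        apply (Hk k); auto. }
  split.
  - destruct (pursuit_advancing P) as (w & L & M & Hw & HL).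
    apply (escapes_of_unbounded E p1 T tau X d w H1 Hw).
    intros B. apply (advancing_unbounded X d c w L M B HL).
  (* From visit [K1] on the fast particle stays away from the rotators that matter, and the slow one
     walks alone in the configurations [C] taken at its own visits. *)
  - destruct (pursuit_far P) as (K1 & HK1).
    set (C := fun k => conf E (S0 + INR (k + K) * sigma)).
    assert (W : walk A u C).
    { constructor; intros n; [apply (it_dir _ _ _ _ _ _ H2) |
        apply (it_turn _ _ _ _ _ _ H2) | apply (it_move _ _ _ _ _ _ H2)]. }
    destruct (solo_advancing A u C K1 W) as (w & L & M & Hw & HL).
    + intros k h Hk Hn. unfold C.
      apply (conf_within I E HE p2 p1 (fun i => proj1 (or_comm _ _) (particles i)) H2).
      * rewrite Hstep. cbn [Nat.add]. rewrite S_INR. lra.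
      * intros t Ht Hp. pose proof (Hlate k).
        destruct (it_visits _ _ _ _ _ _ H1 t h) as (n & -> & ->); auto; [lra|].
        pose proof (Hi k).
        assert (i k < S n)%nat by (apply (tick_lt T tau); auto; rewrite S_INR; lra).
        rewrite (HK1 k n) in Hn; [discriminate|auto|lia].
    + apply (escapes_of_unbounded E p2 S0 sigma Y v w H2 Hw). intros B.
      destruct (advancing_unbounded A u C w L M B HL) as (M' & HM').
      exists (M' + K)%nat. intros m Hm. specialize (HM' (m - K)%nat). unfold A in HM'.
      replace (m - K + K)%nat with m in HM' by lia. apply HM'. lia.
Qed.

Theorem theorem4 (I : initial_condition 2) (E : history 2)
    (HE : evolution I E) (Hsep : no_simultaneous_visits E)
    (Hspeed : Cmod (init_vel I p1) / Cmod (init_vel I p2) >= 30) :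
  escapes E p1 /\ escapes E p2.
Proof.
  destruct (itinerary_exists I E HE p1) as (T & X & d & V1 & H1).
  destruct (itinerary_exists I E HE p2) as (S0 & Y & v & V2 & H2).
  apply (two_particles I E HE Hsep _ _ _ _ _ _ _ _ H1 H2).
  (* The periods are the inverse speeds. *)
  apply (Rmult_le_reg_r (Cmod (init_vel I p1))); auto.
  rewrite Rmult_assoc, Rinv_l, Rmult_comm by lra.
  unfold Rdiv in Hspeed. lra.
Qed.
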